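(* Let $X$ and $Y$ be two finite sets in $\mathbb{R}^d$, and let $G$ be a finite group of isometries of $\mathbb{R}^d$ that acts transitively on both $X$ and $Y$ (that is, every element of $G$ maps $X$ onto $X$ and $Y$ onto $Y$, and the resulting actions of $G$ on $X$ and on $Y$ are transitive). Then, for any real $\lambda \neq 0$, the set $Z = (X\times\{0\})\cup (Y\times\{\lambda\}) \subset \mathbb{R}^{d+1}$ is (up to isometric copy) a subset of a finite transitive set $W$ in $\mathbb{R}^m$ for some $m$. Moreover, if $G$ is soluble then $W$ may be taken so that a soluble group of symmetries of $W$ acts transitively on $W$; in particular, in this case, $Z$ is Ramsey.
   Context: Here $\mathbb{R}^{d+1}$ is viewed as $\mathbb{R}^d\times\mathbb{R}$. A copy of a set means a congruent (isometric) copy, possibly in a Euclidean space of a different dimension. A finite set $W\subset\mathbb{R}^m$ is transitive if its symmetry group (the group of isometries mapping $W$ onto itself) acts transitively on $W$. A finite subset $X$ of some Euclidean space is called Ramsey if for every positive integer $k$ there exists an $n$ such that whenever $\mathbb{R}^n$ is coloured with $k$ colours there is a monochromatic congruent copy of $X$. *)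

(* Defs.v *)
From HB Require Import structures.
From mathcomp Require Import all_boot all_order all_algebra.
From mathcomp Require Import all_fingroup all_solvable.
From mathcomp Require Import boolp classical_sets cardinality reals.

Set Implicit Arguments.
Unset Strict Implicit.
Unset Printing Implicit Defensive.

Import Order.TTheory GRing.Theory Num.Theory.
Local Open Scope classical_set_scope.
Local Open Scope ring_scope.

Section Euclidean.
Variable R : realType.

(* The norm that MathComp-Analysis puts on 'rV[R]_d is the sup norm, so the
   Euclidean distance is defined here. *)
Definition edist d (u v : 'rV[R]_d) : R :=
  Num.sqrt (\sum_(i < d) (u ord0 i - v ord0 i) ^+ 2).

Definition isometry d (f : 'rV[R]_d -> 'rV[R]_d) : Prop :=
  bijective f /\ forall u v, edist (f u) (f v) = edist u v.

Definition congruent d n (A : set 'rV[R]_d) (B : set 'rV[R]_n) : Prop :=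
  exists f : 'rV[R]_d -> 'rV[R]_n,
    f @` A = B /\
    forall u v, A u -> A v -> edist (f u) (f v) = edist u v.

Definition symmetry d (W : set 'rV[R]_d) (f : 'rV[R]_d -> 'rV[R]_d) : Prop :=
  isometry f /\ f @` W = W.

Definition transitive_set d (W : set 'rV[R]_d) : Prop :=
  finite_set W /\
  forall u v, W u -> W v -> exists f, symmetry W f /\ f u = v.

(* A finite group of isometries of R^d is given by a faithful action of a
   finite group: a |-> to^~ a is then a bijection between gT and a finite set
   of isometries closed under composition and inverse. *)
Definition isometry_group (gT : finGroupType) d
    (to : {action gT &-> 'rV[R]_d}) : Prop :=
  (forall a : gT, isometry (fun u => to u a)) /\
  (forall a : gT, (forall u, to u a = u) -> a = 1%g).

(* MathComp's [transitive _, on _ | _] needs the acted-on type to be finite. *)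
Definition acts_transitively (gT : finGroupType) d
    (to : {action gT &-> 'rV[R]_d}) (A : set 'rV[R]_d) : Prop :=
  (forall a : gT, (fun u => to u a) @` A = A) /\
  (forall u v, A u -> A v -> exists a : gT, to u a = v).

Definition ramsey d (A : set 'rV[R]_d) : Prop :=
  finite_set A /\
  forall k : nat, (0 < k)%N ->
    exists n : nat, forall c : 'rV[R]_n -> 'I_k,
      exists (B : set 'rV[R]_n) (i : 'I_k),
        congruent A B /\ forall u, B u -> c u = i.

Definition two_layers d (X Y : set 'rV[R]_d) (lambda : R) : set 'rV[R]_(d + 1) :=
  [set row_mx x (const_mx 0) | x in X] `|`
  [set row_mx y (const_mx lambda) | y in Y].

Definition copy_included d m (Z : set 'rV[R]_d) (W : set 'rV[R]_m) : Prop :=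
  exists Z' : set 'rV[R]_m, congruent Z Z' /\ Z' `<=` W.

End Euclidean.

(* Main.v *)
Require Import Defs.
From HB Require Import structures.
From mathcomp Require Import all_boot all_order all_algebra.
From mathcomp Require Import all_fingroup all_solvable.
From mathcomp Require Import boolp classical_sets cardinality reals.
From mathcomp Require Import functions topology zify ring.
Set Implicit Arguments.
Unset Strict Implicit.
Unset Printing Implicit Defensive.
Import Order.TTheory GRing.Theory Num.Theory.
Local Open Scope classical_set_scope.

(** The proof has two independent halves.

    Embedding.  Choose [x1] in [X] and [y1] in [Y], and consider the cyclic
    sequence of points of R^d x R made of [x1] at height [t] followed, at height
    0, by [n + 1] points leading from [y1] towards [x1] in equal steps.  The
    wreath product of [G] with the cyclic group acts on such sequences by
    isometries, transitively on the orbit [W] of this one.  Putting a point of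
    [X] at the first place gives an element of [W], and so does putting a point
    of [Y] at the first place of the sequence shifted by one.  These are copies
    of [X] and [Y], and the squared distance from the copy of [x] to that of [y]
    is |x - y|^2 + |x1 - y1|^2 / (n + 1) + 2 t^2 ([sqdist_lower_upper]).  For [n]
    large, [t] can be chosen so that the last two terms add up to lambda^2.
    The wreath product is soluble if [G] is ([wreath_solvable]).

    Ramsey property.  It remains to see that an orbit of a soluble finite group
    [H] of isometries is Ramsey, a theorem of Kriz.  The combinatorial statement
    ([solvable_monochromatic]) provides a number [L] depending on [H] only such
    that every finite colouring of the long words over [H] is constant on the
    values of some word in one variable, with exactly [L] letters of the form
    (variable times constant) and all other letters constant.  Since the
    variable letters act isometrically and their number is known beforehand,
    scaling by L^(-1/2) makes these values a congruent copy of the orbit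
    ([ramsey_orbit]).  The statement is proved by induction along a subnormal
    series with cyclic factors: if colours can be made constant on the cosets of
    a subgroup, even for words in several variables, then a cyclic group permutes
    these cosets and the case of a cyclic alphabet merges its orbits
    ([partition_property_merge]).

    Cyclic alphabet ([cyclic_line]).  For every finite colouring of words over
    the integers modulo [m] there are words w_0, ..., w_m such that the colour of
    w_0 t w_1 (t+1) w_2 ... (t+m-1) w_m does not depend on [t].  In a group this
    is an identity: with x_i in place of the letter [i], and x_0^-1, x_(-1)^-1,
    x_(-2)^-1, ... in place of w_1, w_2, w_3, ..., the product is independent of
    [t] because everything cancels ([rotation_cancel]).  Words do not have
    inverses, but some limits of words do: the translations by words have a
    compact closure, which is a semigroup of operators on sets of words, and if
    [e] is a minimal idempotent of it, the operators [e a e] form a group with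
    identity [e] ([minimal_idempotent_group]).  Approximating the operators that
    solve the problem there by words solves it for words ([realize_operators]),
    and compactness of the space of colourings bounds their length. *)

(** * Minimal idempotents in compact right topological semigroups *)

(** Zorn's lemma applied to the complements in [K]; compactness gives the
    nonempty intersection of a chain. *)
Lemma compact_chain_minimal (M : topologicalType) (K : set M)
    (Q : set M -> Prop) :
  compact K -> closed K -> K !=set0 -> Q K ->
  (forall F : set (set M), F !=set0 -> (forall C, F C -> Q C) ->
     Q (\bigcap_(C in F) C)) ->
  exists L, [/\ closed L, L !=set0, L `<=` K, Q L &
    forall C, closed C -> C !=set0 -> C `<=` L -> Q C -> C = L].
Proof.
move=> cK clK K0 QK Qcap.
pose good C := [/\ closed C, C !=set0 & Q C].
have [|A [[clL L0 QL] Amax]] := @Zorn_bigcup M (fun A => good (K `\` A)).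
  move=> F FP Fchain; case: (pselect (F !=set0)) => [F0|/set0P/negP]; last first.
    by rewrite negbK => /eqP->; rewrite bigcup_set0 setD0; split.
  pose G := [set K `\` A | A in F].
  have GE : K `\` \bigcup_(A in F) A = \bigcap_(C in G) C.
    apply/seteqP; split=> [x [Kx nFx] _ [A FA <-]|x Gx].
      by split=> // Ax; apply: nFx; exists A.
    have [A FA] := F0; split; first by have [] : (K `\` A) x by apply: Gx; exists A.
    by move=> [B FB Bx]; have [] : (K `\` B) x by apply: Gx; exists B.
  have G0 : G !=set0 by have [A FA] := F0; exists (K `\` A), A.
  have Ggood C : G C -> good C by move=> [A FA <-]; exact: FP.
  rewrite GE; split.
  - by apply: closed_bigI => C /Ggood[].
  - have Gfil : ProperFilter (filter_from G id).
      apply: filter_from_proper; last by move=> C /Ggood[].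
      apply: filter_from_filter => // _ _ [A FA <-] [B FB <-].
      have [AB|BA] := Fchain _ _ FA FB.
        by exists (K `\` B); [exists B|move=> x [Kx Bx]; split; split=> // /AB].
      by exists (K `\` A); [exists A|move=> x [Kx Ax]; split; split=> // /BA].
    have [|p [Kp clp]] := cK _ Gfil.
      by have [_ [A FA _]] := G0; exists (K `\` A); [exists A|exact: subDsetl].
    exists p => C GC; have [clC _ _] := Ggood _ GC.
    by apply: clC => B Bp; apply: clp => //; exists C.
  - by apply: Qcap => // C /Ggood[].
exists (K `\` A); split=> // C clC C0 CL QC.
apply/seteqP; split=> // x [Kx Ax]; apply: contrapT => Cx.
apply: (Amax (~` C)).
  split; first by move=> y Ay Cy; have [] := CL _ Cy.
  by move=> /(_ x Cx).
rewrite setDE setCK setIC setIidl; last by move=> y /CL[].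
by split.
Qed.

Section CompactSemigroup.
Variables (M : topologicalType) (op : M -> M -> M).
Hypothesis opA : associative op.
Hypothesis op_cont : forall a, continuous (op^~ a).
Hypothesis hM : hausdorff_space M.
Variable K : set M.
Hypothesis cK : compact K.
Hypothesis K0 : K !=set0.
Hypothesis opK : forall a b, K a -> K b -> K (op a b).

Lemma closed_translate (C : set M) a : compact C -> closed (op^~ a @` C).
Proof.
move=> cC; apply: compact_closed => //; apply: continuous_compact => //.
exact/continuous_subspaceT.
Qed.

(** A minimal closed left ideal [L] satisfies [K q = L] for each of its points
    [q], so [e] can be recovered by multiplying [a e] on the left.  The
    idempotent itself comes from Ellis' argument: in a minimal closed
    subsemigroup [J] of [L], both [J e] and the stabiliser of [e] are closed
    subsemigroups, hence equal to [J]. *)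
Lemma minimal_idempotent : exists e, [/\ K e, op e e = e &
  forall a, K a -> exists b, K b /\ op b (op a e) = e].
Proof.
have clK : closed K := compact_closed hM cK.
pose ideal C := forall a c, K a -> C c -> C (op a c).
have [| |L [clL L0 LK idL minL]] := compact_chain_minimal (Q := ideal) cK clK K0.
- by move=> a c; exact: opK.
- by move=> F _ FQ a c Ka cF C FC; apply: FQ => //; exact: cF.
have cL : compact L := subclosed_compact clL cK LK.
have Kq q : L q -> op^~ q @` K = L.
  move=> Lq; apply: minL; first exact: closed_translate.
  - by have [x Kx] := K0; exists (op x q), x.
  - by move=> _ [x Kx <-]; exact: idL.
  - by move=> a _ Ka [x Kx <-]; exists (op a x); [exact: opK|rewrite opA].
pose subsg C := forall a c, C a -> C c -> C (op a c).
have [| |J [clJ J0 JL sgJ minJ]] :=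
  compact_chain_minimal (Q := subsg) cL clL L0.
- by move=> a c La Lc; apply: idL => //; exact: LK.
- by move=> F _ FQ a c aF cF C FC; apply: FQ => //; [exact: aF|exact: cF].
have cJ : compact J := subclosed_compact clJ cL JL.
have [e Je] := J0.
have JeE : op^~ e @` J = J.
  apply: minJ; first exact: closed_translate.
  - by exists (op e e), e.
  - by move=> _ [x Jx <-]; exact: sgJ.
  - move=> _ _ [x Jx <-] [y Jy <-]; exists (op (op x e) y); last by rewrite opA.
    by apply: (sgJ) => //; exact: sgJ.
have stabE : J `&` op^~ e @^-1` [set e] = J.
  apply: minJ.
  - apply: closedI => //; apply: preimage_closed; first by move=> x _; exact: op_cont.
    exact/accessible_closed_set1/hausdorff_accessible.
  - by have : J e by []; rewrite -{1}JeE => -[b Jb be]; exists b.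
  - by move=> x [].
  - move=> a c [Ja ae] [Jc ce]; split; first exact: sgJ.
    by rewrite /preimage /= -opA ce.
exists e; split; first exact/LK/JL.
  by have [] : (J `&` op^~ e @^-1` [set e]) e by rewrite stabE.
move=> a Ka; have : L e by exact: JL.
rewrite -(Kq (op a e)); last by apply: idL => //; exact: JL.
by move=> [b Kb be]; exists b.
Qed.

(** Every element of the monoid [e K e] has a left inverse in it, by
    minimality of [e]; hence this monoid is a group. *)
Lemma minimal_idempotent_group : exists e, [/\ K e, op e e = e &
  forall a, K a -> exists b,
    [/\ K b, op e b = b, op b e = b, op b (op e (op a e)) = e &
        op (op e (op a e)) b = e]].
Proof.
have [e [Ke ee einv]] := minimal_idempotent.
exists e; split=> // a Ka.
have linv a' : K a' -> op e a' = a' -> op a' e = a' ->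
    exists b, [/\ K b, op e b = b, op b e = b & op b a' = e].
  move=> Ka' ea' a'e; have [b [Kb]] := einv _ Ka'; rewrite a'e => ba'.
  exists (op e (op b e)); split; first by do 2?apply: opK => //.
  - by rewrite opA ee.
  - by rewrite -!opA ee.
  - by rewrite -!opA ea' ba' ee.
set a' := op e (op a e).
have ea' : op e a' = a' by rewrite /a' opA ee.
have a'e : op a' e = a' by rewrite /a' -!opA ee.
have [|b [Kb eb be ba']] := linv a' _ ea' a'e; first by do 2?apply: opK => //.
have [c [Kc ec ce cb]] := linv _ Kb eb be.
exists b; split=> //.
suff -> : a' = c by [].
by rewrite -ea' -cb -opA ba' ce.
Qed.

End CompactSemigroup.

(** * A product that is invariant under rotation *)

Section Zigzag.
Variables (Y : Type) (D : Y -> Prop) (x b : nat -> Y -> Y).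
Hypothesis xD : forall i v, D v -> D (x i v).
Hypothesis bD : forall i v, D v -> D (b i v).
Hypothesis xbK : forall i v, D v -> x i (b i v) = v.
Hypothesis bxK : forall i v, D v -> b i (x i v) = v.

(** In the word x_p b_(p+n-1) x_(p+1) b_(p+n-2) ... x_(p+n-1) b_p, where [b i]
    is inverse to [x i] on [D], any two letters at equal distances from the two
    ends are inverse to each other, so everything cancels from the middle.  The
    induction goes from [n] to [n + 2] by peeling off two letters at each end. *)
Lemma zigzag_cancel n p v : D v ->
  foldr (fun j u => x (p + j) (b (p + n - j.+1) u)) v (iota 0 n) = v.
Proof.
suff: forall q u, D u ->
    foldr (fun j u => x (q + j) (b (q + n - j.+1) u)) u (iota 0 n) = u /\
    foldr (fun j u => x (q + j) (b (q + n.+1 - j.+1) u)) u (iota 0 n.+1) = u.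
  by move=> H Dv; have [] := H p v Dv.
elim: n => [|n IH] q u Du.
  by rewrite /= addn0 addn1 subSS subn0 xbK.
split; first by have [] := IH q u Du.
have -> : iota 0 n.+2 = 0 :: rcons [seq 1 + i | i <- iota 0 n] n.+1.
  have -> : n.+2 = 1 + (n + 1) by lia.
  by rewrite 2!iotaD -cats1 -iotaDl.
rewrite /= foldr_rcons foldr_map addn0.
have -> : (fun j u => x (q + (1 + j)) (b (q + n.+2 - (1 + j).+1) u)) =
          (fun j u => x (q.+1 + j) (b (q.+1 + n - j.+1) u)).
  by apply/funext => j; apply/funext => w; congr (x _ (b _ _)); lia.
have [-> _] := IH q.+1 (x (q + n.+1) (b (q + n.+2 - n.+2) u))
  (xD _ (bD _ Du)).
rewrite addnK addnS subn1 /= bxK ?xbK //; exact: bD.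
Qed.

(** The reason why cyclic groups can be treated: for letters indexed modulo [m],
    the product of the x_(t+j) x_(-j)^-1 for j < m is trivial for every rotation
    [t].  It splits into two zigzags, one for the indices from [t] up to [m] and
    one for the indices from [1] up to [t - 1]. *)
Lemma rotation_cancel m t v : 0 < t <= m -> (forall i, x (i + m) = x i) ->
  D v -> foldr (fun j u => x (t + j) (b (m - j) u)) v (iota 0 m) = v.
Proof.
move=> /andP[t0 tm] xm Dv.
have mE : m = (m - t).+1 + t.-1 by lia.
rewrite {2}mE iotaD foldr_cat add0n -[X in iota X t.-1]addn0 iotaDl foldr_map.
have -> : (fun j u => x (t + ((m - t).+1 + j)) (b (m - ((m - t).+1 + j)) u)) =
          (fun j u => x (1 + j) (b (1 + t.-1 - j.+1) u)).
  apply/funext => j; apply/funext => w.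
  by rewrite -(xm (1 + j)); congr (x _ (b _ _)); lia.
rewrite zigzag_cancel //.
rewrite -[RHS](zigzag_cancel (m - t).+1 t Dv).
congr foldr; apply/funext => j; apply/funext => w.
by congr (x _ (b _ _)); lia.
Qed.

End Zigzag.

(** * The semigroup of limits of translations of words *)

Section WordOperators.
Import ArrowAsProduct.

Lemma compact_predicates (I : eqType) : compact [set: I -> bool].
Proof.
have := @tychonoff _ (fun _ : I => bool) _ (fun=> bool_compact).
by congr compact; apply/seteqP; split.
Qed.

Lemma near_predicate (I : eqType) (y : I -> bool) (u : I) :
  nbhs y [set z : I -> bool | z u = y u].
Proof.
have := @proj_continuous _ (fun _ : I => bool) u y.
by move=> /(_ [set b | b = y u]); apply.
Qed.

Section Translations.
Variable T : eqType.
Notation X := (seq T -> bool).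

Lemma compact_operators : compact [set: X -> X].
Proof.
have := @tychonoff _ (fun _ : X => X) _ (fun=> @compact_predicates (seq T)).
by congr compact; apply/seteqP; split.
Qed.

Lemma hausdorff_operators : hausdorff_space (X -> X).
Proof.
do 2![apply: hausdorff_product => _]; exact: discrete_hausdorff.
Qed.

Lemma near_operator (f : X -> X) (y : X) u :
  nbhs f [set g : X -> X | g y u = f y u].
Proof.
have := @proj_continuous _ (fun _ : X => X) y f.
by move=> /(_ [set z | z u = f y u]); apply; exact: near_predicate.
Qed.

(** For pointwise convergence, composition is continuous in its left argument
    only; this is the one-sided continuity that [minimal_idempotent] needs. *)
Lemma precomp_continuous (f : X -> X) : continuous (fun g : X -> X => g \o f).
Proof.
move=> g; have FF : Filter ((fun h : X -> X => h \o f) @ nbhs g).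
  exact: fmap_filter.
apply/(@pointwise_cvgP X X _ _ FF) => y.
exact: (@proj_continuous _ (fun _ : X => X) (f y) g).
Qed.

Definition translation (w : seq T) : X -> X := fun y u => y (u ++ w).

(** The closure of the right translations for pointwise convergence.  Reading
    [f y [::]] as membership of [y] in an ultrafilter, this is the semigroup of
    ultrafilters on words. *)
Definition approximable : set (X -> X) :=
  [set f | forall ps : seq (X * seq T),
     exists w, {in ps, forall p, f p.1 p.2 = translation w p.1 p.2}].

Lemma approximable_closed : closed approximable.
Proof.
move=> f clf ps.
have Ff : Filter (nbhs f) by exact: nbhs_filter.
have : nbhs f [set g | {in ps, forall p, g p.1 p.2 = f p.1 p.2}].
  elim: ps => [|q ps IH]; first by apply: filterE => g p.
  apply: filterS (filterI (near_operator f q.1 q.2) IH) => g [gq gps] p.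
  by rewrite inE => /predU1P[->|/gps].
move=> /clf[g [/(_ ps)[w gw] gf]]; exists w => p pps.
by rewrite -gf // gw.
Qed.

Lemma approximable_compact : compact approximable.
Proof.
exact: subclosed_compact approximable_closed compact_operators (@subsetT _ _).
Qed.

Lemma approximable_translation w : approximable (translation w).
Proof. by move=> ps; exists w. Qed.

Lemma approximable_comp f g :
  approximable f -> approximable g -> approximable (f \o g).
Proof.
move=> Kf Kg ps.
have [w fw] := Kf [seq (g p.1, p.2) | p <- ps].
have [w' gw'] := Kg [seq (p.1, p.2 ++ w) | p <- ps].
exists (w ++ w') => p pps.
have /= -> := fw _ (map_f (fun p => (g p.1, p.2)) pps).
rewrite /translation.
by have /= -> := gw' _ (map_f (fun p => (p.1, p.2 ++ w)) pps); rewrite /translation catA.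
Qed.

Fixpoint interleave (ls : seq T) (ws : seq (seq T)) : seq T :=
  match ls, ws with
  | l :: ls', w :: ws' => l :: w ++ interleave ls' ws'
  | _, _ => [::]
  end.

(** The operator counterpart of [interleave]: the words between the letters
    are replaced by the operators [fs]. *)
Definition insert_letters (ls : seq T) (fs : seq (X -> X)) (y : X) : X :=
  foldr (fun lf v => translation [:: lf.1] (lf.2 v)) y (zip ls fs).

(** The operators can be replaced by words one at a time from the left.  The
    same words serve all the letter sequences [ls j] and all the sets [y j] at
    once because an approximable operator agrees with a single translation on
    finitely many data. *)
Lemma realize_operators (J : finType) (fs : seq (X -> X)) :
  (forall f, f \in fs -> approximable f) ->
  forall (ls : J -> seq T) (y : J -> X) (u : J -> seq T),
  (forall j, size (ls j) = size fs) ->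
  exists ws, size ws = size fs /\
    forall j, insert_letters (ls j) fs (y j) (u j) =
              y j (u j ++ interleave (ls j) ws).
Proof.
elim: fs => [|f fs IH] Kfs ls y u szl.
  by exists [::]; split=> // j; case: (ls j) (szl j) => //= _; rewrite cats0.
pose z j := insert_letters (behead (ls j)) fs (y j).
have /choice[l0 lsE] : forall j, exists l, ls j = l :: behead (ls j).
  by move=> j; case: (ls j) (szl j) => // l l' _; exists l.
have [w fw] := Kfs f (mem_head _ _) [seq (z j, u j ++ [:: l0 j]) | j <- enum J].
have [||ws [szw wsE]] := IH _ (fun j => behead (ls j)) y (fun j => u j ++ l0 j :: w).
- by move=> g gfs; apply: Kfs; rewrite inE gfs orbT.
- by move=> j; rewrite size_behead szl.
exists (w :: ws); split=> [|j]; first by rewrite /= szw.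
rewrite lsE /insert_letters /= -/(insert_letters _ _ _) -/(z j).
rewrite {1}/translation.
have /= -> := fw _ (map_f (fun j => (z j, u j ++ [:: l0 j])) (mem_enum predT j)).
by rewrite /translation -catA /z wsE -catA.
Qed.

(** Write a_i for the translation by the letter [a i]; put x_i = e a_i e and let
    b_i be its inverse in the group with identity [e].  By [rotation_cancel] the
    operator e a_t b_m a_(t+1) b_(m-1) ... is the same for all rotations [t];
    applied to the indicator of each colour and approximated by words, this says
    that the words obtained for the different [t] have the same colour. *)
Lemma monochromatic_rotations (C : finType) (c : seq T -> C) m (a : nat -> T) :
  (forall i, a (i + m) = a i) ->
  exists w0 ws w1, size ws = m /\
    forall t t', 0 < t <= m -> 0 < t' <= m ->
      c (w0 ++ interleave [seq a (t + j) | j <- iota 0 m] ws ++ w1) =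
      c (w0 ++ interleave [seq a (t' + j) | j <- iota 0 m] ws ++ w1).
Proof.
move=> am.
have [e [Ke ee egrp]] := @minimal_idempotent_group (X -> X : topologicalType)
  (fun f g : X -> X => f \o g) (fun f g h => erefl) precomp_continuous
  hausdorff_operators approximable approximable_compact
  (ex_intro _ _ (approximable_translation [::])) approximable_comp.
have /choice[B BP] := fun l => egrp _ (approximable_translation [:: l]).
have fE (f g : X -> X) : f = g -> f =1 g by move=> ->.
have eK v : e (e v) = e v by exact: fE ee v.
pose x i v := e (translation [:: a i] (e v)).
pose b i := B (a i).
have eb i v : e (b i v) = b i v.
  by have [_ /fE/(_ v) H _ _ _] := BP (a i).
have be i v : b i (e v) = b i v.
  by have [_ _ /fE/(_ v) H _ _] := BP (a i).
have bx i v : e v = v -> b i (x i v) = v.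
  by move=> ev; rewrite -[RHS]ev; have [_ _ _ /fE/(_ v) H _] := BP (a i).
have xb i v : e v = v -> x i (b i v) = v.
  by move=> ev; rewrite -[RHS]ev; have [_ _ _ _ /fE/(_ v) H] := BP (a i).
pose y col : X := e (fun w => c w == col).
pose ls t := [seq a (t + j) | j <- iota 0 m].
pose fs := [seq b (m - j) | j <- iota 0 m].
have insE t col : 0 < t <= m -> e (insert_letters (ls t) fs (y col)) = y col.
  move=> tm.
  rewrite -[RHS](@rotation_cancel _ (fun v => e v = v) x b _ _ _ _ m t _ tm) //.
  - rewrite /ls /fs; elim: (iota 0 m) => /= [|j s IH]; first exact: eK.
    rewrite -IH /x /insert_letters /= -/(insert_letters _ _ _).
    by rewrite be eb.
  - by move=> i v _; exact: eK.
  - by move=> i; apply/funext => v; rewrite /x am.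
  - exact: eK.
pose J := ('I_m * C)%type.
pose lsJ (j : J) := ls j.1.+1.
have Kf f : f \in fs -> approximable f.
  by move=> /mapP[i _ ->]; have [] := BP (a (m - i)).
have [w0 w0E] := Ke [seq (insert_letters (lsJ j) fs (y j.2), [::]) | j : J].
have [|ws [szw wsE]] := realize_operators Kf (fun j => y j.2) (fun=> w0) (ls := lsJ).
  by move=> j; rewrite !size_map.
have [w1 w1E] :=
  Ke [seq (fun w => c w == j.2, w0 ++ interleave (lsJ j) ws) | j : J].
have colE (t : 'I_m) col :
    (c (w0 ++ interleave (ls t.+1) ws ++ w1) == col) = y col [::].
  have jJ := mem_enum predT ((t, col) : J).
  rewrite -(insE t.+1 col) ?ltn_ord //.
  have /= -> := w0E _ (map_f _ jJ); rewrite /translation /=.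
  have /= -> := wsE (t, col); rewrite /y.
  have /= -> := w1E _ (map_f _ jJ).
  by rewrite /translation -catA.
exists w0, ws, w1; split=> [|[//|t] [//|t'] /= tm tm'].
  by rewrite szw size_map size_iota.
apply/eqP; rewrite -[t]/(val (Ordinal tm)) -[t']/(val (Ordinal tm')).
by rewrite colE -(colE (Ordinal tm')) eqxx.
Qed.

End Translations.

(** * Monochromatic lines over a cyclic alphabet *)

Section UniformLine.
Variable m : nat.
Notation T := 'I_m.+1.
Local Open Scope ring_scope.

(** A line is a word whose letters carry a flag: the flagged ones move, all by
    the same amount [t], around the cycle. *)
Definition line_at (t : nat) (s : seq (T * bool)) : seq T :=
  [seq if p.2 then p.1 + inZp t else p.1 | p <- s].

Definition static (w : seq T) : seq (T * bool) := [seq (l, false) | l <- w].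

Fixpoint moving_interleave (ls : seq T) (ws : seq (seq T)) : seq (T * bool) :=
  match ls, ws with
  | l :: ls', w :: ws' => (l, true) :: static w ++ moving_interleave ls' ws'
  | _, _ => [::]
  end.

Lemma line_at_static t w : line_at t (static w) = w.
Proof. by rewrite /line_at -map_comp map_id_in. Qed.

Lemma count_static w : count snd (static w) = 0%N.
Proof. by elim: w. Qed.

Lemma line_at_moving t ls ws :
  line_at t (moving_interleave ls ws) =
  interleave [seq l + inZp t | l <- ls] ws.
Proof.
elim: ls ws => [|l ls IH] [|w ws] //=.
by rewrite /line_at map_cat -!/(line_at _ _) line_at_static IH.
Qed.

Lemma count_moving ls ws : size ws = size ls ->
  count snd (moving_interleave ls ws) = size ls.
Proof.
elim: ls ws => [|l ls IH] [|w ws] //= [/IH <-].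
by rewrite count_cat count_static.
Qed.

Lemma cyclic_line_unbounded (C : finType) (c : seq T -> C) :
  exists s, count snd s = m.+1 /\ forall t, c (line_at t s) = c (line_at 0 s).
Proof.
pose a i : T := inZp i.
have aD i j : a (i + j)%N = a j + a i.
  by apply: val_inj; rewrite /= modnDm addnC.
have am i : a (i + m.+1)%N = a i by apply: val_inj; rewrite /= modnDr.
have [w0 [ws [w1 [szw wsE]]]] := monochromatic_rotations c am.
pose ls := [seq a j | j <- iota 0 m.+1].
exists (static w0 ++ moving_interleave ls ws ++ static w1); split.
  rewrite !count_cat !count_static count_moving ?size_map ?size_iota //.
  by rewrite addn0.
have atE t : line_at t (static w0 ++ moving_interleave ls ws ++ static w1) =
    w0 ++ interleave [seq a (t + j)%N | j <- iota 0 m.+1] ws ++ w1.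
  rewrite /line_at !map_cat -!/(line_at _ _) !line_at_static line_at_moving.
  rewrite -map_comp; congr (_ ++ interleave _ _ ++ _).
  by apply: eq_map => j /=; rewrite aD.
have reduce t : exists2 t', (0 < t' <= m.+1)%N & forall j, a (t + j)%N = a (t' + j)%N.
  (* The representative of t modulo m + 1 lying between 1 and m + 1. *)
  exists ((t + m) %% m.+1).+1%N; first by rewrite ltn_pmod.
  move=> j; apply: val_inj => /=.
  by rewrite addSnnS modnDml -(modnDr (t + j)); congr (_ %% _)%N; lia.
move=> t; rewrite !atE; have [t1 t1m E1] := reduce t; have [t2 t2m E2] := reduce 0%N.
by rewrite (eq_map E1) (eq_map E2); exact: wsE.
Qed.

Lemma cluster_agree (I : eqType) (F : nat -> I -> bool) (g : I -> bool) :
  cluster (F @ \oo) g ->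
  forall n0 (ps : seq I), exists2 n, (n0 <= n)%N & {in ps, F n =1 g}.
Proof.
move=> clg n0 ps.
have Fg : Filter (nbhs g) by exact: nbhs_filter.
have gps : nbhs g [set z : I -> bool | {in ps, z =1 g}].
  elim: ps => [|q ps IH]; first by apply: filterE => z p.
  apply: filterS (filterI (near_predicate g q) IH) => z [zq zps] p.
  by rewrite inE => /predU1P[->|/zps].
have [z [[n n0n <-] Fnps]] : F @` [set n | (n0 <= n)%N] `&`
    [set z : I -> bool | {in ps, z =1 g}] !=set0.
  apply: clg => //; exists n0 => // n /= n0n; by exists n.
by exists n.
Qed.

(** The length of the line is bounded in terms of the colours alone: colourings
    without short lines would accumulate at a colouring without lines.  The
    number of moving letters is [m.+1], whatever the number of colours; this is
    what later fixes the scale of the monochromatic copies. *)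
Theorem cyclic_line (C : finType) :
  exists N, forall c : seq T -> C, exists s,
    [/\ size s = N, count snd s = m.+1 &
        forall t, c (line_at t s) = c (line_at 0 s)].
Proof.
apply: contrapT => noN.
have /choice[c cP] : forall N, exists c : seq T -> C, forall s,
    size s = N -> count snd s = m.+1 ->
    ~ forall t, c (line_at t s) = c (line_at 0 s).
  move=> N; apply: contrapT => noc; apply: noN; exists N => c.
  apply: contrapT => nos; apply: noc; exists c => s szs cs cE.
  by apply: nos; exists s.
(* Short words are coloured by padding them with static letters. *)
pose pad N (w : seq T) := w ++ nseq (N - size w) 0.
pose F N (p : C * seq T) := c N (pad N p.2) == p.1.
have [|g [_ clg]] := @compact_predicates (C * seq T)%type (F @ \oo) _.
  exact: filterT.
have agree := cluster_agree clg.
have /choice[cl clP] : forall w, exists col, g (col, w).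
  move=> w; have [n _ /= nE] := agree 0%N [seq (col, w) | col : C].
  exists (c n (pad n w)).
  by rewrite -nE ?map_f ?mem_enum // /F eqxx.
have [s [cs sE]] := cyclic_line_unbounded cl.
have [n sn nE] := agree (size s) [seq (col, line_at t s) | col <- enum C, t <- iota 0 m.+1].
have cn t : c n (pad n (line_at t s)) = cl (line_at t s).
  apply/eqP.
  have -> : line_at t s = line_at (t %% m.+1) s.
    apply: eq_map => p; case: ifP => // _; congr (_ + _).
    by apply: val_inj; rewrite /= modn_mod.
  rewrite -[_ == _]/(F n (cl (line_at (t %% m.+1) s), line_at (t %% m.+1) s)).
  rewrite nE //; apply/allpairsP.
  exists (cl (line_at (t %% m.+1) s), t %% m.+1)%N.
  by split; [rewrite mem_enum|rewrite mem_iota ltn_pmod|].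
pose s' := s ++ static (nseq (n - size s) 0).
have s'E t : line_at t s' = pad n (line_at t s).
  rewrite /s' {1}/line_at map_cat -!/(line_at _ _) line_at_static.
  by rewrite /pad size_map.
apply: (cP n s').
- by rewrite size_cat size_map size_nseq subnKC.
- by rewrite count_cat count_static addn0.
- by move=> t; rewrite !s'E !cn sE.
Qed.

End UniformLine.

End WordOperators.

(** * Monochromatic parameter words over soluble groups *)

Section ParameterWords.
Variable gT : finGroupType.
Implicit Types (s : seq (gT * nat + gT)) (x : nat -> gT).
Local Open Scope group_scope.

Definition eval_symbol x (y : gT * nat + gT) : gT :=
  match y with inl gl => x gl.2 * gl.1 | inr g => g end.

(** A parameter word has constant letters [inr g] and variable letters
    [inl (g, l)], which stand for the [l]-th variable multiplied by [g]. *)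
Definition word_eval x s := [seq eval_symbol x y | y <- s].

Definition uses l (y : gT * nat + gT) : bool :=
  if y is inl gl then gl.2 == l else false.

Lemma eq_eval x x' s :
  (forall l, (0 < count (uses l) s)%N -> x l = x' l) -> word_eval x s = word_eval x' s.
Proof.
elim: s => //= y s IH xx'; rewrite IH => [|l sl]; last first.
  by apply: xx'; rewrite /= addn_gt0 sl orbT.
congr (_ :: _); case: y xx' => //= gl xx'.
by rewrite xx' //= eqxx.
Qed.

Definition shift_symbol N (y : gT * nat + gT) : gT * nat + gT :=
  match y with inl gl => inl (gl.1, N + gl.2)%N | inr g => inr g end.

Lemma eval_shift N x s :
  word_eval x (map (shift_symbol N) s) = word_eval (fun l => x (N + l)%N) s.
Proof. by rewrite /word_eval -map_comp; apply: eq_map; case. Qed.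

Lemma count_shift N l s :
  count (uses l) (map (shift_symbol N) s) =
  if (l < N)%N then 0%N else count (uses (l - N)) s.
Proof.
rewrite count_map; case: ltnP => lN; last first.
  apply: eq_count => -[[g k]|g] //=; apply/eqP/eqP; lia.
apply/eqP; rewrite -leqn0 leqNgt -has_count.
by apply/hasPn => -[[g k]|g] //= _; apply/eqP; lia.
Qed.

(** The number [L] of uses of each variable is chosen before the colours: this is
    what makes the resulting copies isometric instead of merely similar.  Several
    variables are there for the sake of the induction, which substitutes the
    letters of a line for them. *)
Definition partition_property (e : rel gT) (L N : nat) : Prop :=
  forall C : finType, exists n, forall c : seq gT -> C, exists s,
    [/\ size s = n, forall l, count (uses l) s = (if l < N then L else 0)%N &
        forall x x', (forall l, e (x l) (x' l)) -> c (word_eval x s) = c (word_eval x' s)].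

(** The product argument of Ramsey theory: the last block of letters is treated
    with the colourings of the other blocks as colours, and conversely. *)
Lemma partition_property_power e L N :
  partition_property e L 1 -> partition_property e L N.
Proof.
move=> P1; elim: N => [|N PN] C.
  by exists 0%N => c; exists [::].
have [n1 P1'] := PN {ffun gT -> C}.
have [n2 P2'] := P1 {ffun n1.-tuple gT -> C}.
exists (n1 + n2)%N => c.
have [s2 [sz2 cnt2 inv2]] :=
  P2' (fun w => [ffun v : n1.-tuple gT => c (v ++ w)]).
have [s1 [sz1 cnt1 inv1]] :=
  P1' (fun v => [ffun g : gT => c (v ++ word_eval (fun=> g) s2)]).
exists (s1 ++ map (shift_symbol N) s2); split.
- by rewrite size_cat size_map sz1 sz2.
- move=> l; rewrite count_cat cnt1 count_shift cnt2 ltnS.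
  by case: (ltngtP l N) => lN; do ?case: ifP => //; lia.
- move=> x x' exx'; rewrite /word_eval !map_cat -!/(word_eval _ _) !eval_shift.
  have const2 y : word_eval (fun l => y (N + l)%N) s2 = word_eval (fun=> y N) s2.
    by apply: eq_eval => l; rewrite cnt2; case: l => //=; rewrite addn0.
  have sz y : size (word_eval y s1) == n1 by rewrite size_map sz1.
  have := inv1 _ _ exx' => /ffunP/(_ (x N)); rewrite !ffunE const2 => ->.
  have /ffunP/(_ (Tuple (sz x'))) := inv2 (fun l => x (N + l)%N) (fun l => x' (N + l)%N)
     (fun l => exx' _).
  by rewrite !ffunE /= -const2.
Qed.

Section MergeOrbit.
Variables (k : gT) (m : nat).

(** Modulo [e], right multiplication by [k] is a well-defined permutation of
    order dividing [m.+1]. *)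
Definition cyclic_compatible (e : rel gT) : Prop :=
  [/\ reflexive e, symmetric e, transitive e,
      forall i j, e i j -> e (i * k) (j * k) & forall i, e i (i * k ^+ m.+1)].

Variable e : rel gT.
Hypothesis ek : cyclic_compatible e.

Lemma cyclic_compatible_expg n i j : e i j -> e (i * k ^+ n) (j * k ^+ n).
Proof.
have [_ _ _ eM _] := ek.
by elim: n => [|n IH] eij; rewrite ?expg0 ?mulg1 // expgSr !mulgA; exact/eM/IH.
Qed.

Lemma cyclic_compatible_mod i n : e (i * k ^+ n) (i * k ^+ (n %% m.+1)).
Proof.
have [erefl esym etrans _ eper] := ek.
rewrite {1}(divn_eq n m.+1) addnC; elim: (n %/ m.+1)%N => [|q IH].
  by rewrite mul0n addn0 erefl.
apply: etrans IH; rewrite mulSn addnCA addnC expgD mulgA.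
by rewrite esym; exact: eper.
Qed.

Variable r : gT.

Definition orbit_class : pred gT := fun i => [exists t : 'I_m.+1, e (r * k ^+ t) i].

Definition merge_orbit : rel gT := fun i j => e i j || (orbit_class i && orbit_class j).

Lemma orbit_classP i : reflect (exists n, e (r * k ^+ n) i) (orbit_class i).
Proof.
have [_ esym etrans _ _] := ek.
apply: (iffP existsP) => [[t et]|[n en]]; first by exists t.
exists (inord (n %% m.+1)); rewrite inordK ?ltn_pmod //.
by apply: etrans en; rewrite esym; exact: cyclic_compatible_mod.
Qed.

Lemma orbit_class_eq i j : e i j -> orbit_class i = orbit_class j.
Proof.
have [_ esym etrans _ _] := ek.
move=> eij; apply/orbit_classP/orbit_classP => -[n en]; exists n.
  exact: etrans en eij.
by apply: etrans en _; rewrite esym.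
Qed.

Lemma merge_orbit_sub i j : e i j -> merge_orbit i j.
Proof. by rewrite /merge_orbit => ->. Qed.

Lemma merge_orbit_cycle n : merge_orbit r (r * k ^+ n).
Proof.
have [erefl _ _ _ _] := ek.
apply/orP; right; apply/andP; split; apply/orbit_classP.
  by exists 0%N; rewrite mulg1 erefl.
by exists n; rewrite erefl.
Qed.

Lemma merge_orbit_compatible : cyclic_compatible merge_orbit.
Proof.
have [erefl esym etrans eM eper] := ek; split.
- by move=> i; rewrite /merge_orbit erefl.
- by move=> i j; rewrite /merge_orbit esym andbC.
- move=> j i l /orP[eij|/andP[Oi Oj]] /orP[ejl|/andP[Oj' Ol]].
  + by apply: merge_orbit_sub; exact: etrans ejl.
  + by rewrite /merge_orbit (orbit_class_eq eij) Oj' Ol orbT.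
  + by rewrite /merge_orbit -(orbit_class_eq ejl) Oi Oj orbT.
  + by rewrite /merge_orbit Oi Ol orbT.
- have OM i : orbit_class i -> orbit_class (i * k).
    move=> /orbit_classP[n en]; apply/orbit_classP; exists n.+1.
    by rewrite expgSr mulgA; exact: eM.
  move=> i j /orP[/eM/merge_orbit_sub//|/andP[/OM Oi /OM Oj]].
  by rewrite /merge_orbit Oi Oj orbT.
- by move=> i; exact/merge_orbit_sub/eper.
Qed.

Definition line_symbol (s : seq ('I_m.+1 * bool)) (y : gT * nat + gT) :
    gT * nat + gT :=
  match y with
  | inl gl => let a := nth (ord0, false) s gl.2 in
              if a.2 then inl (k ^+ a.1 * gl.1, 0%N) else inr (r * k ^+ a.1 * gl.1)
  | inr g => inr g
  end.

Definition line_value (s : seq ('I_m.+1 * bool)) (i : gT) (l : nat) : gT :=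
  let a := nth (ord0, false) s l in (if a.2 then i else r) * k ^+ a.1.

Lemma eval_line (s : seq ('I_m.+1 * bool)) x w :
  word_eval x (map (line_symbol s) w) = word_eval (line_value s (x 0%N)) w.
Proof.
rewrite /word_eval -map_comp; apply: eq_map => -[gl|g] //=.
by rewrite /line_value; case: ifP; rewrite //= mulgA.
Qed.

Lemma count_line (s : seq ('I_m.+1 * bool)) L w :
  (forall l, count (uses l) w = if l < size s then L else 0)%N ->
  forall l, count (uses l) (map (line_symbol s) w) =
    (if l < 1 then L * count snd s else 0)%N.
Proof.
move=> cw l; rewrite count_map.
case: ltnP => l1; last first.
  apply/eqP; rewrite -leqn0 leqNgt -has_count; apply/hasPn => -[gl|g] //= _.
  by case: ifP => //= _; rewrite eq_sym -lt0n.
have -> : l = 0%N by case: l l1.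
transitivity (\sum_(i < size s) (nth (ord0, false) s i).2 * count (uses i) w)%N.
  elim: w {cw} => [|y w IH] /=; first by rewrite big1 // => i _; rewrite muln0.
  rewrite IH; under [RHS]eq_bigr => i _ do rewrite mulnDr.
  rewrite big_split /=; congr (_ + _)%N; case: y => [[g j]|g] /=; last first.
    by rewrite big1 // => i _; rewrite muln0.
  have [js|js] := ltnP j (size s); last first.
    rewrite nth_default //= big1 // => i _.
    by case: eqP (ltn_ord i) => [<-|]; rewrite ?muln0 // ltnNge js.
  rewrite (bigD1 (Ordinal js)) //= eqxx muln1 big1 ?addn0; last first.
    by move=> i /eqP ij; case: eqP => [ji|]; rewrite ?muln0 //; case: ij; exact: val_inj.
  by case: ifP.
under eq_bigr => i _ do rewrite cw ltn_ord.
rewrite -big_distrl /= mulnC; congr (_ * _)%N.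
rewrite -sum1_count (big_nth (ord0, false)) big_mkord.
by rewrite [RHS]big_mkcond; apply: eq_bigr => i _; case: (nth _ _ _).2.
Qed.

(** Take a parameter word with [N] variables whose colour only depends on the
    variables modulo [e].  Letting each of them run through the elements
    [r * k ^+ t] colours the words over a cycle of length [m.+1]; a
    monochromatic line gives a parameter word in one variable, where a moving
    letter becomes the variable times a power of [k], and a static letter a
    constant of the orbit of [r]. *)
Lemma partition_property_merge L :
  partition_property e L 1 -> partition_property merge_orbit (L * m.+1) 1.
Proof.
have [erefl esym etrans _ _] := ek.
move=> P1 C; have [N lineN] := cyclic_line m C.
have [n PN] := partition_property_power N P1 C.
exists n => c; have [w [szw cw inv]] := PN c.
have [s [szs cs sE]] :=
  lineN (fun a => c (word_eval (fun l => r * k ^+ (nth ord0 a l : 'I_m.+1)) w)).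
exists (map (line_symbol s) w); split; first by rewrite size_map.
  by move=> l; rewrite (@count_line _ L) ?cs // szs.
have inve i j : e i j -> c (word_eval (line_value s i) w) = c (word_eval (line_value s j) w).
  move=> eij; apply: inv => l; apply: cyclic_compatible_expg.
  by case: ifP => // _; exact: erefl.
have invO i : orbit_class i -> c (word_eval (line_value s i) w) =
    c (word_eval (fun l => r * k ^+ (nth ord0 (line_at 0 s) l : 'I_m.+1)) w).
  move=> /existsP[t /inve <-]; rewrite -(sE t); apply: inv => l.
  rewrite /line_value; have [ls|ls] := ltnP l (size s); last first.
    by rewrite !nth_default ?size_map //= erefl.
  rewrite (nth_map (ord0, false)) //=; case: (nth _ s l) => a [] /=; last exact: erefl.
  rewrite -mulgA -expgD modnDmr addnC.
  exact: cyclic_compatible_mod.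
move=> x x' /(_ 0%N) /orP[exx|/andP[Ox Ox']]; rewrite !eval_line.
  exact: inve.
by rewrite !invO.
Qed.

End MergeOrbit.

Lemma partition_property_sub (e e' : rel gT) L N :
  (forall i j, e i j -> e' i j) ->
  partition_property e' L N -> partition_property e L N.
Proof.
move=> ee' P C; have [n Pn] := P C; exists n => c.
have [s [szs cs inv]] := Pn c; exists s; split=> // x x' exx'.
by apply: inv => l; exact: ee'.
Qed.

Lemma merge_all_orbits (k : gT) m e L (rs : seq gT) :
  cyclic_compatible k m e -> (0 < L)%N -> partition_property e L 1 ->
  exists e' L', [/\ cyclic_compatible k m e', (0 < L')%N,
    partition_property e' L' 1, forall i j, e i j -> e' i j &
    forall r n, r \in rs -> e' r (r * k ^+ n)].
Proof.
move=> ek L0 P1; elim: rs => [|r rs [e' [L' [e'k L'0 P1' ee' cyc]]]].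
  by exists e, L; split.
exists (merge_orbit k m e' r), (L' * m.+1)%N; split.
- exact: merge_orbit_compatible.
- by rewrite muln_gt0 L'0.
- exact: partition_property_merge.
- by move=> i j /ee'; exact: merge_orbit_sub.
- move=> q n; rewrite inE => /predU1P[->|/cyc qrs].
    exact: merge_orbit_cycle.
  exact/merge_orbit_sub/qrs.
Qed.

Definition left_coset_rel (K : {group gT}) : rel gT := fun i j => i^-1 * j \in K.

(** For [k] in [K] outside [H], the cosets of [K] are the orbits of [k] on the
    cosets of [H]; these orbits are merged one after the other. *)
Lemma partition_property_extension (H K : {group gT}) L :
  H <| K -> prime #|K : H| -> (0 < L)%N ->
  partition_property (left_coset_rel H) L 1 ->
  exists2 L', (0 < L')%N & partition_property (left_coset_rel K) L' 1.
Proof.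
move=> nHK pr L0 PH; have [sHK nH] := andP nHK.
have [k kK kH] : exists2 k, k \in K & k \notin H.
  have /fintype.properP[_ //] : H \proper K.
  by rewrite finset.properEneq sHK andbT; apply: contraTneq pr => ->; rewrite indexgg.
set p := #|K : H| in pr.
have pE : p.-1.+1 = p by rewrite prednK // prime_gt0.
have kN := fintype.subsetP nH _ kK.
have oK : #|K / H| = p by rewrite card_quotient.
have kp : k ^+ p \in H.
  apply: coset_idr; first exact: groupX.
  by rewrite morphX // -oK expg_cardG // mem_quotient.
have gen g : g \in K -> exists n, (k ^+ n)^-1 * g \in H.
  move=> gK; have gN := fintype.subsetP nH _ gK.
  have : coset H g \in <[coset H k]>.
    suff -> : <[coset H k]> = K / H by exact: mem_quotient.
    apply/eqP; rewrite eqEcard cycle_subG mem_quotient //= -orderE oK.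
    have := order_dvdG (mem_quotient H kK); rewrite oK => /(primeP pr).2.
    case/pred2P => [/eqP|->//]; rewrite order_eq1 => /eqP/coset_idr kH'.
    by rewrite kH' in kH.
  case/cycleP => n gE; exists n; apply: coset_idr; first by rewrite groupM ?groupV ?groupX.
  by rewrite morphM ?groupV ?groupX // morphV ?groupX // morphX //= gE mulVg.
have ek : cyclic_compatible k p.-1 (left_coset_rel H).
  split.
  - by move=> i; rewrite /left_coset_rel mulVg group1.
  - by move=> i j; rewrite /left_coset_rel -groupV invMg invgK.
  - move=> j i l; rewrite /left_coset_rel => ij jl.
    by rewrite -(mulKVg j l) mulgA groupM.
  - move=> i j ij; rewrite /left_coset_rel invMg -mulgA (mulgA i^-1) -[_ * _]/(_ ^ _).
    by rewrite memJ_norm.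
  - by move=> i; rewrite /left_coset_rel mulKg pE.
have [e [L' [[_ _ etrans _ _] L'0 Pe sube cyc]]] :=
  merge_all_orbits (enum gT) ek L0 PH.
exists L' => //; apply: partition_property_sub Pe => i j /gen[n kn].
apply: etrans (cyc i n _) (sube _ _ _); first by rewrite mem_enum.
by rewrite /left_coset_rel invMg -mulgA.
Qed.

(** Induction on the order: a nontrivial soluble group has a normal subgroup of
    prime index. *)
Theorem solvable_partition_property (K : {group gT}) : solvable K ->
  exists2 L, (0 < L)%N & partition_property (left_coset_rel K) L 1.
Proof.
have [n] := ubnP #|K|; elim: n K => // n IH K; rewrite ltnS => Kn solK.
have [K1|/(sol_prime_factor_exists solK)[H nHK pr]] := eqVneq (K : {set gT}) 1.
  exists 1%N => // C; exists 1%N => c; exists [:: inl (1, 0%N)].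
  split=> // [l|x x' /(_ 0%N)]; first by rewrite /= addn0; case: l.
  by rewrite /left_coset_rel K1 inE /= !mulg1 -eq_mulVg1 => /eqP->.
have [||L L0 PL] := IH H.
- apply: leq_trans Kn; rewrite -(Lagrange (normal_sub nHK)).
  by rewrite ltn_Pmulr ?prime_gt1 ?cardG_gt0.
- exact: solvableS (normal_sub nHK) solK.
exact: partition_property_extension PL.
Qed.

Definition is_variable (y : gT * nat + gT) : bool :=
  if y is inl _ then true else false.

Corollary solvable_monochromatic : solvable [set: gT]%G ->
  exists2 L, (0 < L)%N & forall C : finType, exists n, forall c : seq gT -> C,
    exists s, [/\ size s = n, count is_variable s = L &
      forall g h, c (word_eval (fun=> g) s) = c (word_eval (fun=> h) s)].
Proof.
move=> /(@solvable_partition_property [set: gT]%G)[L L0 P]; exists L => // C.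
have [n Pn] := P C; exists n => c; have [s [szs cs inv]] := Pn c.
exists s; split=> [||g h]; [by []| |].
  rewrite -[RHS](cs 0%N); apply: eq_in_count => -[[g l]|g] // sg /=.
  have : (0 < count (uses l) s)%N.
    by rewrite -has_count; apply/hasP; exists (inl (g, l)) => //=.
  by rewrite cs; case: l {sg}.
by apply: inv => l; rewrite /left_coset_rel inE.
Qed.

End ParameterWords.

(** * Orbits of soluble groups of isometries are Ramsey *)

Local Open Scope ring_scope.

Lemma total_actM (aT : finGroupType) (rT : Type) (to : {action aT &-> rT}) x a b :
  to x (a * b)%g = to (to x a) b.
Proof.
case: to => to H /=; have [_ toM] := H.
exact: (toM x a b (finset.in_setT a) (finset.in_setT b)).
Qed.

Lemma total_act1 (aT : finGroupType) (rT : Type) (to : {action aT &-> rT}) x :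
  to x 1%g = x.
Proof.
have inj1 : injective (fun x => to x 1%g).
  by case: to => to H /=; have [inj _] := H; exact: inj.
by apply: inj1; rewrite -total_actM mulg1.
Qed.

Section ActionIsometry.
Variable R : realType.

Lemma isometry_of_action (aT : finGroupType) m (B : {action aT &-> 'rV[R]_m}) a :
  (forall u v, edist (B u a) (B v a) = edist u v) -> Defs.isometry (fun u => B u a).
Proof.
move=> isoB; split=> //; exists (fun u => B u a^-1%g) => u.
  by rewrite -total_actM mulgV total_act1.
by rewrite -total_actM mulVg total_act1.
Qed.

End ActionIsometry.

Section OrbitSets.
Variables (R : realType) (hT : finGroupType) (m : nat).
Variables (H : {action hT &-> 'rV[R]_m}) (w0 : 'rV[R]_m).
Hypothesis isoH : isometry_group H.

Definition orbit_set : set 'rV[R]_m := [set H w0 a | a in [set: hT]].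

Lemma orbit_set_transitively : acts_transitively H orbit_set.
Proof.
split=> [a|_ _ [b _ <-] [c _ <-]]; last first.
  by exists (b^-1 * c)%g; rewrite -total_actM mulKVg.
apply/seteqP; split=> [_ [_ [b _ <-] <-]|_ [b _ <-]].
  by exists (b * a)%g; rewrite // total_actM.
exists (H w0 (b * a^-1)%g); first by exists (b * a^-1)%g.
by rewrite -total_actM mulgKV.
Qed.

Lemma orbit_set_transitive : transitive_set orbit_set.
Proof.
split; first by apply: finite_image; exact: finite_finset.
move=> u v Wu Wv; have [a <-] := orbit_set_transitively.2 u v Wu Wv.
exists (fun u => H u a); split=> //; split; first exact: isoH.1.
exact: orbit_set_transitively.1.
Qed.

End OrbitSets.

Section EuclideanPowers.
Variable R : realType.

Definition sqdist d (u v : 'rV[R]_d) : R := \sum_(i < d) (u ord0 i - v ord0 i) ^+ 2.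

Lemma sqdist_ge0 d (u v : 'rV[R]_d) : 0 <= sqdist u v.
Proof. by apply: sumr_ge0 => i _; exact: sqr_ge0. Qed.

Lemma edist_eq d n (u v : 'rV[R]_d) (u' v' : 'rV[R]_n) :
  edist u v = edist u' v' <-> sqdist u v = sqdist u' v'.
Proof.
rewrite /edist -!/(sqdist _ _); split=> [|->//].
by move=> /(congr1 (fun x => x ^+ 2)); rewrite !sqr_sqrtr ?sqdist_ge0.
Qed.

Lemma sqdist_mxvec n d (A B : 'M[R]_(n, d)) :
  sqdist (mxvec A) (mxvec B) = \sum_i sqdist (row i A) (row i B).
Proof.
rewrite /sqdist; under [RHS]eq_bigr do under eq_bigr do rewrite !mxE.
rewrite pair_big /=.
rewrite (reindex _ (curry_mxvec_bij n d)) /=.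
apply: eq_bigr => -[i j] _ /=.
by rewrite !mxvecE.
Qed.

Lemma sqdistZ d a (u v : 'rV[R]_d) : sqdist (a *: u) (a *: v) = a ^+ 2 * sqdist u v.
Proof.
by rewrite /sqdist mulr_sumr; apply: eq_bigr => i _; rewrite !mxE -mulrBr exprMn.
Qed.

Lemma sqdistxx d (u : 'rV[R]_d) : sqdist u u = 0.
Proof. by rewrite /sqdist big1 // => i _; rewrite subrr expr0n. Qed.

Lemma sqdist_row_mx p q (u u' : 'rV[R]_p) (v v' : 'rV[R]_q) :
  sqdist (row_mx u v) (row_mx u' v') = sqdist u u' + sqdist v v'.
Proof.
by rewrite /sqdist big_split_ord /=; congr (_ + _); apply: eq_bigr => i _;
  rewrite ?row_mxEl ?row_mxEr.
Qed.

Lemma sqdist_const (s t : R) :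
  sqdist (const_mx s : 'rV_1) (const_mx t) = (s - t) ^+ 2.
Proof. by rewrite /sqdist big_ord1 !mxE. Qed.

Lemma sqdist_sym p (u v : 'rV[R]_p) : sqdist u v = sqdist v u.
Proof. by apply: eq_bigr => i _; rewrite -sqrrN opprB. Qed.

(** The words over [hT] are placed in a power of the space, one letter per
    coordinate block.  A variable letter contributes to squared distances as
    much as the original set does, since [hT] acts by isometries, and a constant
    letter contributes nothing; so a parameter word with [L] variable letters,
    scaled by the inverse square root of [L], traces a congruent copy. *)
Lemma ramsey_orbit (hT : finGroupType) m (H : {action hT &-> 'rV[R]_m}) w0 :
  (forall a, Defs.isometry (fun u => H u a)) -> solvable [set: hT]%G ->
  ramsey (orbit_set H w0).
Proof.
move=> isoH solH; split; first by apply: finite_image; exact: finite_finset.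
move=> k k0; have [L L0 mono] := solvable_monochromatic solH.
have [n monon] := mono 'I_k; exists (n * m)%N => c.
pose scale : R := (Num.sqrt L%:R)^-1.
pose emb (p : nat -> 'rV[R]_m) : 'rV[R]_(n * m) :=
  mxvec (\matrix_(i < n) (scale *: p i)).
have [s [szs cs inv]] := monon (fun g => c (emb (fun i => H w0 (nth 1%g g i)))).
pose f u := emb (fun i => match nth (inr 1%g) s i with
                          | inl gl => H u gl.1 | inr g => H w0 g end).
(* [f] is defined on the whole space, so that no element of the group has to be
   recovered from the point of the orbit. *)
have fE g : f (H w0 g) = emb (fun i => H w0 (nth 1%g (word_eval (fun=> g) s) i)).
  rewrite /f /emb; congr mxvec; apply/row_matrixP => i.
  rewrite !rowK (nth_map (inr 1%g)) ?szs //; congr (_ *: _).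
  by case: (nth _ s i) => [gl|//]; rewrite /= total_actM.
exists (f @` orbit_set H w0).
exists (c (f (H w0 1%g))); split; last first.
  by move=> _ [_ [g _ <-] <-]; rewrite !fE; exact: inv.
exists f; split=> // u v _ _; apply/edist_eq.
rewrite sqdist_mxvec.
under eq_bigr => i _ do rewrite !rowK sqdistZ.
rewrite -mulr_sumr.
have -> : \sum_(i < n) sqdist
    (match nth (inr 1%g) s i with inl gl => H u gl.1 | inr g => H w0 g end)
    (match nth (inr 1%g) s i with inl gl => H v gl.1 | inr g => H w0 g end) =
    (count (@is_variable hT) s)%:R * sqdist u v.
  rewrite -szs -(big_mkord xpredT (fun i => sqdist
    (match nth (inr 1%g) s i with inl gl => H u gl.1 | inr g => H w0 g end)
    (match nth (inr 1%g) s i with inl gl => H v gl.1 | inr g => H w0 g end))).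
  rewrite -(big_nth (inr 1%g) xpredT (fun y => sqdist
    (match y with inl gl => H u gl.1 | inr g => H w0 g end)
    (match y with inl gl => H v gl.1 | inr g => H w0 g end))).
  elim: (s) => [|y s' IH]; first by rewrite big_nil mul0r.
  rewrite big_cons IH /= natrD mulrDl; congr (_ + _); case: y => [gl|g].
    by rewrite mul1r; apply/edist_eq; have [_] := isoH gl.1.
  by rewrite mul0r sqdistxx.
rewrite cs mulrA exprVn sqr_sqrtr ?ler0n // mulVf ?mul1r // pnatr_eq0.
by rewrite -lt0n.
Qed.

Lemma ramsey_copy d m (Z : set 'rV[R]_d) (W : set 'rV[R]_m) :
  finite_set Z -> copy_included Z W -> ramsey W -> ramsey Z.
Proof.
move=> finZ [Z' [[f [fZ fiso]] Z'W]] [_ ramW]; split=> // k /ramW[n nW].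
exists n => c; have [B [i [[g [gW giso]] Bi]]] := nW c.
have ZW u : Z u -> W (f u) by move=> Zu; apply: Z'W; rewrite -fZ; exists u.
exists (g @` Z'), i; split; last first.
  by move=> _ [u Z'u <-]; apply: Bi; rewrite -gW; exists u => //; exact: Z'W.
exists (g \o f); split; first by rewrite -fZ image_comp.
by move=> u v Zu Zv /=; rewrite giso ?fiso //; exact: ZW.
Qed.

End EuclideanPowers.

(** * Wreath products with a cyclic group *)

(** A homomorphism maps a perfect group to a perfect group, and a soluble group
    has no nontrivial perfect subgroup. *)
Lemma solvable_perfect_trivial (aT rT : finGroupType) (P : {group aT})
    (f : {morphism P >-> rT}) : solvable [set: rT]%G -> P \subset [~: P, P]%g ->
  forall x, x \in P -> f x = 1%g.
Proof.
move=> solR perfP x Px.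
have /forall_inP/(_ (f @* P)%G) := solR.
rewrite finset.subsetI finset.subsetT -morphimR // morphimS // => /(_ isT)/eqP fP1.
by apply/set1gP; rewrite -fP1 mem_morphim.
Qed.

Section Wreath.
Variables (gT : finGroupType) (n : nat).

(** The multiplication below is the one for which [(f, s)] acts on [n.+1]-tuples
    on the right by shifting the places by [s] and then acting with [f j] at
    place [j]. *)
Definition wreath : Type := ({ffun 'I_n.+1 -> gT} * 'I_n.+1)%type.

HB.instance Definition _ := Finite.on wreath.

Local Open Scope group_scope.

Definition wreath_mul (u v : wreath) : wreath :=
  ([ffun j => u.1 (j + v.2)%R * v.1 j], (v.2 + u.2)%R).
Definition wreath_one : wreath := ([ffun=> 1], 0%R).
Definition wreath_inv (u : wreath) : wreath :=
  ([ffun j => (u.1 (j - u.2)%R)^-1], (- u.2)%R).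

Lemma wreath_mulA : associative wreath_mul.
Proof.
move=> u v w; congr pair; last by rewrite /= addrA.
by apply/ffunP => j; rewrite !ffunE /= mulgA addrA.
Qed.

Lemma wreath_mul1 : left_id wreath_one wreath_mul.
Proof.
case=> f s; congr pair; last by rewrite /= addr0.
by apply/ffunP => j; rewrite !ffunE /= mul1g.
Qed.

Lemma wreath_mulV : left_inverse wreath_one wreath_inv wreath_mul.
Proof.
move=> u; congr pair; last by rewrite /= subrr.
by apply/ffunP => j; rewrite !ffunE /= addrK mulVg.
Qed.

HB.instance Definition _ :=
  Finite_isGroup.Build wreath wreath_mulA wreath_mul1 wreath_mulV.

(** A perfect subgroup has trivial shifts because the shifts commute; then the
    coordinates are homomorphisms on it, hence trivial as well. *)
Lemma wreath_solvable : solvable [set: gT]%G -> solvable [set: wreath]%G.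
Proof.
move=> solG; apply/forall_inP => P /fintype.subset_trans/(_ (subsetIr _ _)) perfP.
have shiftM : {in P &, {morph (fun u : wreath => u.2) : u v / u * v}}.
  by move=> u v _ _ /=; exact: addrC.
have solI : solvable [set: 'I_n.+1]%G.
  by apply: abelian_sol; apply/centsP => i _ j _; exact: addrC.
have P2 := solvable_perfect_trivial (Morphism shiftM) solI perfP.
have coordM j : {in P &, {morph (fun u : wreath => u.1 j) : u v / u * v}}.
  by move=> u v Pu Pv; rewrite /= ffunE (P2 _ Pv) addr0.
have P1 j := solvable_perfect_trivial (Morphism (coordM j)) solG perfP.
apply/eqP/trivgP/fintype.subsetP => -[f s] Pu; apply/set1gP.
congr pair; last exact: P2 Pu.
by apply/ffunP => j; rewrite ffunE; exact: P1 Pu.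
Qed.

End Wreath.

Section WreathAction.
Variables (R : realType) (gT : finGroupType) (n q : nat).
Variable A : {action gT &-> 'rV[R]_q}.
Hypothesis isoA : isometry_group A.

(** A tuple of points is encoded by the rows of [vec_mx u], so that its squared
    distances are the sums of those of its members ([sqdist_mxvec]). *)
Definition wreath_act (u : 'rV[R]_(n.+1 * q)) (h : wreath gT n) : 'rV[R]_(n.+1 * q) :=
  mxvec (\matrix_(i < n.+1) A (row (i + h.2) (vec_mx u)) (h.1 i)).

Lemma wreath_act1 : wreath_act^~ 1%g =1 id.
Proof.
move=> u; rewrite /wreath_act -[RHS]vec_mxK; congr mxvec.
by apply/row_matrixP => i; rewrite rowK /= ffunE total_act1 addr0.
Qed.

Lemma wreath_actM u : act_morph wreath_act u.
Proof.
move=> g h; rewrite /wreath_act mxvecK; congr mxvec.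
apply/row_matrixP => i; rewrite !rowK /= ffunE total_actM; do 2!congr (A _ _).
by rewrite addrA.
Qed.

Definition wreath_action := TotalAction wreath_act1 wreath_actM.

Lemma wreath_isometry_group : (0 < q)%N -> isometry_group wreath_action.
Proof.
move=> q0; split=> [h|[f s] fix_h].
  apply: isometry_of_action => u v; apply/edist_eq.
  rewrite /= /wreath_act -{2}[u]vec_mxK -{2}[v]vec_mxK !sqdist_mxvec.
  rewrite [RHS](reindex_inj (addIr h.2)); apply: eq_bigr => i _.
  by rewrite !rowK; apply/edist_eq; have [_] := isoA.1 (h.1 i).
(* Rows can be prescribed at will in the equation satisfied by [(f, s)]. *)
have rowE (p : 'I_n.+1 -> 'rV[R]_q) i : A (p (i + s)) (f i) = p i.
  have := fix_h (mxvec (\matrix_i p i)); rewrite /= /wreath_act mxvecK.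
  by move=> /(can_inj mxvecK)/(congr1 (row i)); rewrite !rowK.
(* If [s] were not 0, the row 0 would be determined by the row [s]. *)
have s0 : s = 0.
  apply/eqP/negPn/negP => s0.
  have := rowE (fun i => if i == s then 0 else const_mx 1) 0.
  have := rowE (fun i => if i == s then 0 else const_mx 0) 0.
  rewrite add0r eqxx eq_sym (negPf s0) => -> /rowP/(_ (Ordinal q0)).
  by rewrite !mxE => /eqP; rewrite eq_sym oner_eq0.
congr pair; last exact: s0.
apply/ffunP => i; rewrite ffunE; apply: isoA.2 => u.
by have := rowE (fun=> u) i.
Qed.

End WreathAction.

(** * Embedding two layers into an orbit *)

Section Layers.
Variables (R : realType) (d : nat).
Variables (gT : finGroupType) (G : {action gT &-> 'rV[R]_d}).
Hypothesis isoG : isometry_group G.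

Definition height_act (u : 'rV[R]_(d + 1)) (a : gT) : 'rV[R]_(d + 1) :=
  row_mx (G (lsubmx u) a) (rsubmx u).

Lemma height_act1 : height_act^~ 1%g =1 id.
Proof. by move=> u; rewrite /height_act total_act1 hsubmxK. Qed.

Lemma height_actM u : act_morph height_act u.
Proof.
by move=> a b; rewrite /height_act row_mxKl row_mxKr total_actM.
Qed.

Definition height_action := TotalAction height_act1 height_actM.

Lemma height_isometry_group : isometry_group height_action.
Proof.
split=> [a|a fix_a].
  apply: isometry_of_action => u v; apply/edist_eq.
  rewrite -[in RHS](hsubmxK u) -[in RHS](hsubmxK v) /= /height_act !sqdist_row_mx.
  by congr (_ + _); apply/edist_eq; have [_] := isoG.1 a.
apply: isoG.2 => u; have := fix_a (row_mx u 0).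
by rewrite /= /height_act row_mxKl row_mxKr => /eq_row_mx[].
Qed.

Variables (x1 y1 : 'rV[R]_d) (t : R) (n : nat).

(** A cyclic sequence of points of [R^(d+1)]: [x1] at height [t], then, at height
    [0], the points leading from [y1] towards [x1] in [n.+1] equal steps, the
    last of which is the return to [x1]. *)
Definition chain_point (j : nat) : 'rV[R]_(d + 1) :=
  if j is i.+1 then
    row_mx (y1 + (i%:R / n.+1%:R) *: (x1 - y1)) (const_mx 0)
  else row_mx x1 (const_mx t).

Definition chain : 'rV[R]_(n.+2 * (d + 1)) :=
  mxvec (\matrix_(i < n.+2) chain_point i).

Definition chain_orbit : set 'rV[R]_(n.+2 * (d + 1)) :=
  orbit_set (wreath_action n.+1 height_action) chain.

(** The chain with its first place freed for a point of [X]. *)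
Definition lower_copy (x : 'rV[R]_d) : 'rV[R]_(n.+2 * (d + 1)) :=
  mxvec (\matrix_(i < n.+2)
    if i == 0 then row_mx x (const_mx t) else chain_point i).

(** The chain shifted by one place: the freed first place is now that of [y1],
    and every other place is one step away from its value in [lower_copy]. *)
Definition upper_copy (y : 'rV[R]_d) : 'rV[R]_(n.+2 * (d + 1)) :=
  mxvec (\matrix_(i < n.+2)
    if i == 0 then row_mx y (const_mx 0) else chain_point (nat_of_ord (i + 1)%R)).

Lemma lower_copy_orbit g : chain_orbit (lower_copy (G x1 g)).
Proof.
exists (([ffun i : 'I_n.+2 => if i == 0 then g else 1%g], 0) : wreath gT n.+1) => //.
rewrite /= /wreath_act /lower_copy /chain mxvecK; congr mxvec.
apply/row_matrixP => i; rewrite !rowK [(_, _).2]/= [(_, _).1]/= addr0 ffunE.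
case: eqP => [->|_]; last exact: height_act1.
by rewrite /= /height_act row_mxKl row_mxKr.
Qed.

Lemma upper_copy_orbit g : chain_orbit (upper_copy (G y1 g)).
Proof.
exists (([ffun i : 'I_n.+2 => if i == 0 then g else 1%g], 1) : wreath gT n.+1) => //.
rewrite /= /wreath_act /upper_copy /chain mxvecK; congr mxvec.
apply/row_matrixP => i; rewrite !rowK [(_, _).2]/= [(_, _).1]/= ffunE.
case: eqP => [->|_]; last exact: height_act1.
by rewrite add0r /= /height_act row_mxKl row_mxKr mul0r scale0r addr0.
Qed.

Lemma sqdist_lower x x' : sqdist (lower_copy x) (lower_copy x') = sqdist x x'.
Proof.
rewrite sqdist_mxvec big_ord_recl !rowK /= sqdist_row_mx sqdistxx addr0.
by rewrite big1 ?addr0 // => i _; rewrite !rowK /= sqdistxx.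
Qed.

Lemma sqdist_upper y y' : sqdist (upper_copy y) (upper_copy y') = sqdist y y'.
Proof.
rewrite sqdist_mxvec big_ord_recl !rowK /= sqdist_row_mx sqdistxx addr0.
by rewrite big1 ?addr0 // => i _; rewrite !rowK /= sqdistxx.
Qed.

Lemma sqdist_chain_step i :
  let p j : 'rV[R]_d := y1 + (j%:R / n.+1%:R) *: (x1 - y1) in
  sqdist (p i) (p i.+1) = sqdist x1 y1 / n.+1%:R ^+ 2.
Proof.
have n0 : n.+1%:R != 0 :> R by rewrite pnatr_eq0.
rewrite /sqdist mulr_suml; apply: eq_bigr => j _; rewrite !mxE -[i.+1%:R]natr1.
by move: (n.+1%:R) n0 => N N0; field.
Qed.

(** The [n.+1] steps contribute the square of the distance from [x1] to [y1]
    divided by [n.+1]; the height [t] is met at the first and the last place. *)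
Lemma sqdist_lower_upper x y :
  sqdist (lower_copy x) (upper_copy y) =
  sqdist x y + (sqdist x1 y1 / n.+1%:R + 2 * t ^+ 2).
Proof.
rewrite sqdist_mxvec big_ord_recl !rowK /= sqdist_row_mx sqdist_const subr0.
rewrite -addrA; congr (_ + _).
rewrite big_ord_recr /= !rowK /=.
have -> : ((bump 0 n + 1 %% n.+2) %% n.+2 = 0)%N.
  by rewrite /bump add1n modnDmr addn1 modnn.
rewrite sqdist_row_mx sqdist_const.
under eq_bigr => i _.
  rewrite !rowK /=.
  have -> : ((bump 0 i + 1 %% n.+2) %% n.+2 = i.+2)%N.
    by rewrite /bump add1n modnDmr addn1 modn_small // !ltnS ltn_ord.
  rewrite /= sqdist_row_mx sqdistxx addr0 sqdist_chain_step.
  over.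
rewrite sumr_const card_ord.
have -> : sqdist (y1 + ((0 + n)%:R / n.+1%:R) *: (x1 - y1)) x1 =
    sqdist x1 y1 / n.+1%:R ^+ 2.
  rewrite -(sqdist_chain_step n) divff ?pnatr_eq0 // scale1r.
  by congr sqdist; rewrite addrC subrK.
have n0 : n.+1%:R != 0 :> R by rewrite pnatr_eq0.
rewrite -(mulr_natr _ n); have : n%:R + 1 = n.+1%:R :> R by rewrite natr1.
by move: (n.+1%:R) n0 => N N0 NE; rewrite -NE in N0 *; field.
Qed.

End Layers.

(** Many steps make the contribution of the chain smaller than [lambda ^+ 2],
    and the height [t] makes up for the difference. *)
Lemma two_layers_copy (R : realType) (d : nat) (X Y : set 'rV[R]_d)
    (gT : finGroupType) (G : {action gT &-> 'rV[R]_d}) (lambda : R) :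
  acts_transitively G X -> acts_transitively G Y -> lambda != 0%R ->
  exists x1 y1 t n,
    copy_included (two_layers X Y lambda) (@chain_orbit R d gT G x1 y1 t n).
Proof.
move=> transX transY l0.
(* When the set is empty, the orbit of an arbitrary point contains it. *)
have base (Z : set 'rV[R]_d) : acts_transitively G Z ->
    exists z1, forall z, Z z -> exists a, G z1 a = z.
  move=> transZ; case: (pselect (Z !=set0)) => [[z1 Zz1]|Z0].
    by exists z1 => z Zz; exact: transZ.2.
  by exists 0%R => z Zz; case: Z0; exists z.
have [x1 Xx1] := base _ transX; have [y1 Yy1] := base _ transY.
pose D : R := sqdist x1 y1.
have l2 : (0 < lambda ^+ 2)%R by rewrite exprn_even_gt0.
have [n nD] : exists n, (D / n.+1%:R <= lambda ^+ 2)%R.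
  exists (Num.bound (D / lambda ^+ 2)).
  rewrite ler_pdivrMr ?ltr0n // mulrC -ler_pdivrMr //.
  have D0 : (0 <= D / lambda ^+ 2)%R by rewrite divr_ge0 ?sqdist_ge0 // ltW.
  apply: le_trans (ltW (archi_boundP D0)) _.
  by rewrite ler_nat.
pose t : R := Num.sqrt ((lambda ^+ 2 - D / n.+1%:R) / 2).
exists x1, y1, t, n.
have tE : (D / n.+1%:R + 2 * t ^+ 2 = lambda ^+ 2)%R.
  rewrite sqr_sqrtr ?divr_ge0 ?subr_ge0 //.
  have n0 : n.+1%:R != 0 :> R by rewrite pnatr_eq0.
  by move: (n.+1%:R) n0 => N N0; field.
pose f (z : 'rV[R]_(d + 1)) := if rsubmx z == 0%R
  then lower_copy x1 y1 t n (lsubmx z) else upper_copy x1 y1 t n (lsubmx z).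
have c0 : const_mx lambda != 0%R :> 'rV[R]_1.
  by apply: contraNneq l0 => /rowP/(_ ord0); rewrite !mxE => ->.
have fX x : f (row_mx x (const_mx 0)) = lower_copy x1 y1 t n x.
  by rewrite /f row_mxKl row_mxKr eqxx.
have fY y : f (row_mx y (const_mx lambda)) = upper_copy x1 y1 t n y.
  by rewrite /f row_mxKl row_mxKr (negPf c0).
exists (f @` two_layers X Y lambda); split; last first.
  move=> _ [_ [[x Xx <-]|[y Yy <-]] <-].
    by rewrite fX; have [a <-] := Xx1 _ Xx; exact: lower_copy_orbit.
  by rewrite fY; have [a <-] := Yy1 _ Yy; exact: upper_copy_orbit.
exists f; split=> // _ _ [[x _ <-]|[y _ <-]] [[x' _ <-]|[y' _ <-]];
  apply/edist_eq; rewrite ?fX ?fY sqdist_row_mx sqdist_const.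
- by rewrite sqdist_lower subrr expr0n addr0.
- by rewrite sqdist_lower_upper -/D tE sub0r sqrrN.
- by rewrite sqdist_sym sqdist_lower_upper -/D tE subr0 sqdist_sym.
- by rewrite sqdist_upper subrr expr0n addr0.
Qed.

Theorem theorem1 (R : realType) (d : nat) (X Y : set 'rV[R]_d)
    (gT : finGroupType) (G : {action gT &-> 'rV[R]_d}) (lambda : R)
    (finX : finite_set X) (finY : finite_set Y)
    (isoG : isometry_group G)
    (transX : acts_transitively G X) (transY : acts_transitively G Y)
    (lambda_neq0 : lambda != 0) :
  (exists (m : nat) (W : set 'rV[R]_m),
      transitive_set W /\ copy_included (two_layers X Y lambda) W) /\
  (solvable [set: gT]%G ->
    (exists (m : nat) (W : set 'rV[R]_m),
        [/\ transitive_set W, copy_included (two_layers X Y lambda) W &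
            exists (hT : finGroupType) (H : {action hT &-> 'rV[R]_m}),
              [/\ isometry_group H, acts_transitively H W &
                  solvable [set: hT]%G]]) /\
    ramsey (two_layers X Y lambda)).
Proof.
have [x1 [y1 [t [n copyZ]]]] := two_layers_copy transX transY lambda_neq0.
have isoH : isometry_group (wreath_action n.+1 (height_action G)).
  by apply: wreath_isometry_group; [exact: height_isometry_group|rewrite addn1].
set W := @chain_orbit R d gT G x1 y1 t n in copyZ.
have transW : transitive_set W by exact: orbit_set_transitive isoH.
split; first by exists (n.+2 * (d + 1))%N, W.
move=> solG; have solH := wreath_solvable n.+1 solG.
split.
  exists (n.+2 * (d + 1))%N, W; split=> //.
  exists (wreath gT n.+1), (wreath_action n.+1 (height_action G)).
  by split=> //; exact: orbit_set_transitively.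
apply: ramsey_copy copyZ _; first by rewrite finite_setU; split; exact: finite_image.
by apply: ramsey_orbit solH; exact: isoH.1.
Qed.
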